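(* Let $\mathcal{O}$ be a context specifier. Then the operators $\mathrm{Gen}_{\mathcal{O}}, \mathrm{In}_{\mathcal{O}} : \mathbf{PV} \to \mathbf{PV}$ are the constituents of a Galois connection with lower adjoint $\mathrm{Gen}_{\mathcal{O}}$ and upper adjoint $\mathrm{In}_{\mathcal{O}}$; that is, both are monotone and $\mathrm{Gen}_{\mathcal{O}}(\mathbf{V}) \subseteq \mathbf{W}$ if and only if $\mathbf{V} \subseteq \mathrm{In}_{\mathcal{O}}(\mathbf{W})$ for all pseudovarieties $\mathbf{V},\mathbf{W}$. Moreover, $\mathrm{In}_{\mathcal{O}}$ is continuous and increasing, and $\mathrm{Gen}_{\mathcal{O}}$ is decreasing.
   Context: A pseudovariety is a class of finite semigroups closed under subsemigroups, homomorphic images and finite products (the empty semigroup is allowed). $\mathbf{PV}$ is the complete lattice of pseudovarieties under inclusion; the join of a directed family of pseudovarieties is its union. An operator on $\mathbf{PV}$ is continuous if it is monotone and preserves directed joins; an operator $\alpha$ is increasing (resp. decreasing) if $\mathbf{V}\subseteq\alpha(\mathbf{V})$ (resp. $\alpha(\mathbf{V}) \subseteq \mathbf{V}$) for all $\mathbf{V}$. A context specifier $\mathcal{O}$ is a rule assigning to each finite semigroup $S$ a (possibly empty) set $\mathcal{O}(S)$ of subsemigroups of $S$ such that: (i) for all homomorphisms $\varphi : S \to T$ and $U_S \in \mathcal{O}(S)$ there is $U_T \in \mathcal{O}(T)$ with $\varphi(U_S) \subseteq U_T$; (ii) for all surjective homomorphisms $\varphi : S \to T$ and $U_T \in \mathcal{O}(T)$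 there is $U_S \in \mathcal{O}(S)$ with $\varphi(U_S) = U_T$. For a pseudovariety $\mathbf{V}$: $\mathrm{In}_{\mathcal{O}}(\mathbf{V}) = \{ S \text{ a finite semigroup} : \mathcal{O}(S) \subseteq \mathbf{V} \}$, and $\mathrm{Gen}_{\mathcal{O}}(\mathbf{V})$ is the pseudovariety generated by $\bigcup \{ \mathcal{O}(V) : V \in \mathbf{V} \}$. *)

(* Defs.v *)
From HB Require Import structures.
From mathcomp Require Import all_boot.

Set Implicit Arguments.
Unset Strict Implicit.
Unset Printing Implicit Defensive.

Import Algebra.

Local Open Scope group_scope.

(* Nothing forces a finite semigroup to be inhabited: the empty one is
   included. *)
#[short(type="finSemigroupType")]
HB.structure Definition FinSemigroup := {S of Semigroup S & Finite S}.

Record subsemigroup (S : finSemigroupType) := Subsemigroup {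
  subsemigroup_set :> {set S};
  subsemigroup_mulg : mulg_closed subsemigroup_set
}.

Section SubsemigroupType.
Variables (S : finSemigroupType) (U : subsemigroup S).

Record subsemigroup_type := SubsemigroupElt {
  subsemigroup_val :> S;
  subsemigroup_valP : subsemigroup_val \in subsemigroup_set U
}.

HB.instance Definition _ := [isSub for subsemigroup_val].
HB.instance Definition _ := [Finite of subsemigroup_type by <:].
HB.instance Definition _ :=
  SubChoice_isSubSemigroup.Build S _ subsemigroup_type
    (@subsemigroup_mulg S U).

Definition semigroup_of : finSemigroupType := subsemigroup_type.

End SubsemigroupType.

(* The direct product of the family S, with componentwise multiplication; for
   I empty it is the one-element semigroup. *)
Section Product.
Variables (I : finType) (S : I -> finSemigroupType).

Definition semigroup_prod_mul (f g : {dffun forall i : I, S i}) :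
  {dffun forall i : I, S i} := [ffun i => f i * g i].

Fact semigroup_prod_mulA : associative semigroup_prod_mul.
Proof. by move=> f g h; apply/ffunP => i; rewrite !ffunE mulgA. Qed.

HB.instance Definition _ :=
  isSemigroup.Build {dffun forall i : I, S i} semigroup_prod_mulA.

Definition semigroup_prod : finSemigroupType := {dffun forall i : I, S i}.

End Product.

Definition surjective (A B : Type) (f : A -> B) := forall y, exists x, f x = y.

(* Plain predicates: finSemigroupType lives in a universe too large for the
   type constructor set of classical_sets. *)
Definition semigroup_class := finSemigroupType -> Prop.

Definition class_incl (V W : semigroup_class) := forall S, V S -> W S.

Declare Scope class_scope.
Delimit Scope class_scope with class.
Notation "V `<=` W" := (class_incl V W)
  (at level 70, no associativity) : class_scope.
Local Open Scope class_scope.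

(* Closure under isomorphism is the bijective case of the second clause. *)
Definition is_pseudovariety (V : semigroup_class) :=
  [/\ forall (S : finSemigroupType) (U : subsemigroup S),
        V S -> V (semigroup_of U),
      forall (S T : finSemigroupType) (phi : {multiplicative S -> T}),
        surjective phi -> V S -> V T
    & forall (I : finType) (S : I -> finSemigroupType),
        (forall i, V (S i)) -> V (semigroup_prod S)].

Record pseudovariety := Pseudovariety {
  pv_class :> finSemigroupType -> Prop;
  pv_classP : is_pseudovariety pv_class
}.

Definition pv_generated_class (C : semigroup_class) : semigroup_class :=
  fun S => forall V : pseudovariety, C `<=` V -> V S.

Lemma pv_generatedP C : is_pseudovariety (pv_generated_class C).
Proof.
split=> [S U CS|S T phi phi_surj CS|I S CS] V CV;
  have [sub quo prd] := pv_classP V.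
- by apply/sub/CS.
- by apply: (quo _ _ _ phi_surj); apply: CS.
- by apply: prd => i; apply: CS.
Qed.

(* The least pseudovariety containing C. *)
Definition pv_generated (C : semigroup_class) : pseudovariety :=
  Pseudovariety (@pv_generatedP C).

(* The join in the complete lattice of pseudovarieties, i.e. the pseudovariety
   generated by the union of the members of F. *)
Definition pv_join (F : pseudovariety -> Prop) : pseudovariety :=
  pv_generated (fun S => exists2 V : pseudovariety, F V & V S).

Definition directed (F : pseudovariety -> Prop) :=
  (exists V, F V) /\
  forall V W, F V -> F W -> exists Z, [/\ F Z, V `<=` Z & W `<=` Z].

Definition monotone (alpha : pseudovariety -> pseudovariety) :=
  forall V W : pseudovariety, V `<=` W -> alpha V `<=` alpha W.

(* Equality of pseudovarieties is stated as equality of the classes, that is,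
   as inclusion both ways. *)
Definition preserves_directed_joins (alpha : pseudovariety -> pseudovariety) :=
  forall F : pseudovariety -> Prop, directed F -> forall S : finSemigroupType,
    alpha (pv_join F) S <->
    pv_join (fun W => exists2 V, F V & W = alpha V) S.

Definition continuous (alpha : pseudovariety -> pseudovariety) :=
  monotone alpha /\ preserves_directed_joins alpha.

Definition increasing (alpha : pseudovariety -> pseudovariety) :=
  forall V : pseudovariety, V `<=` alpha V.

Definition decreasing (alpha : pseudovariety -> pseudovariety) :=
  forall V : pseudovariety, alpha V `<=` V.

Definition galois_connection (lower upper : pseudovariety -> pseudovariety) :=
  [/\ monotone lower, monotone upper
    & forall V W : pseudovariety, lower V `<=` W <-> V `<=` upper W].

(* O S U reads: U is a member of the set O(S) of subsemigroups of S. *)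
Definition is_context_specifier
    (O : forall S : finSemigroupType, subsemigroup S -> Prop) :=
  (forall (S T : finSemigroupType) (phi : {multiplicative S -> T})
      (US : subsemigroup S), O S US ->
    exists2 UT : subsemigroup T, O T UT & phi @: US \subset UT) /\
  (forall (S T : finSemigroupType) (phi : {multiplicative S -> T})
      (UT : subsemigroup T), surjective phi -> O T UT ->
    exists2 US : subsemigroup S, O S US & phi @: US = UT).

Record context_specifier := ContextSpecifier {
  context_rule :> forall S : finSemigroupType, subsemigroup S -> Prop;
  context_ruleP : is_context_specifier context_rule
}.

(* A priori only a class of finite semigroups: that it is a pseudovariety
   depends on the axioms of context specifiers. *)
Definition In_class (O : context_specifier) (V : pseudovariety) :
    semigroup_class :=
  fun S => forall U : subsemigroup S, O S U -> V (semigroup_of U).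

Definition Gen (O : context_specifier) (V : pseudovariety) : pseudovariety :=
  pv_generated (fun T => exists S : finSemigroupType, V S /\
    exists2 U : subsemigroup S, O S U & T = semigroup_of U).

(* Main.v *)
Require Import Defs.
From mathcomp Require Import all_boot.
From HB Require Import structures.
From Stdlib Require Import Classical_Prop.

(** The axioms of a context specifier make the class In_O(V) a
    pseudovariety.  Axiom (i), applied to an inclusion
    U -> S or to the projections of a product, places every context of U, or
    of the product, inside a member of V or a product of members of V
    ([pv_embedding]); axiom (ii) exhibits every context of a homomorphic image
    as an image of a context ([In_pseudovariety]).

    The adjunction is then immediate: as W is a pseudovariety, Gen_O(V) is
    included in W exactly when all contexts of members of V lie in W, that is,
    when V is included in In_O(W) ([Gen_leP]).
    Contexts of S are subsemigroups of S, so V is included in In_O(V), and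
    Gen_O(V) in V.

    Continuity is a finiteness argument.  A directed join is the union of its
    members ([pv_join_directed]), and a finite semigroup has finitely many
    subsemigroups, so when all contexts of S lie in the union they already lie
    in one single member of the family ([directed_common]). *)

Set Implicit Arguments.
Unset Strict Implicit.
Unset Printing Implicit Defensive.

Import Algebra.

Local Open Scope group_scope.
Local Open Scope class_scope.

(** * Constructions of homomorphisms *)

Section Corestriction.
Variables (A B : finSemigroupType) (f : {multiplicative A -> B}).
Variables (W : subsemigroup B) (fW : forall x, f x \in W).

Definition corestrict (x : A) : semigroup_of W := SubsemigroupElt (fW x).

Fact corestrict_mulg : {morph corestrict : x y / x * y}.
Proof. by move=> x y; apply: val_inj; rewrite /= gmulfM. Qed.

HB.instance Definition _ :=
  isMultiplicative.Build A (semigroup_of W) corestrict corestrict_mulg.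

End Corestriction.

Section SubsemigroupInclusion.
Variables (S : finSemigroupType) (U : subsemigroup S).

Definition subsemigroup_incl (x : semigroup_of U) : S := val x.

Fact subsemigroup_incl_mulg : {morph subsemigroup_incl : x y / x * y}.
Proof. by []. Qed.

HB.instance Definition _ :=
  isMultiplicative.Build (semigroup_of U) S
    subsemigroup_incl subsemigroup_incl_mulg.

End SubsemigroupInclusion.

Section ProductMorphisms.
Variables (I : finType) (S : I -> finSemigroupType).

Definition semigroup_proj i (x : semigroup_prod S) : S i := x i.

Fact semigroup_proj_mulg i : {morph semigroup_proj i : x y / x * y}.
Proof. by move=> x y; rewrite /semigroup_proj ffunE. Qed.

HB.instance Definition _ i :=
  isMultiplicative.Build (semigroup_prod S) (S i)
    (semigroup_proj i) (semigroup_proj_mulg i).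

Variables (A : finSemigroupType) (f : forall i, {multiplicative A -> S i}).

Definition semigroup_pairing (x : A) : semigroup_prod S := [ffun i => f i x].

Fact semigroup_pairing_mulg : {morph semigroup_pairing : x y / x * y}.
Proof. by move=> x y; apply/ffunP => i; rewrite !ffunE gmulfM. Qed.

HB.instance Definition _ :=
  isMultiplicative.Build A (semigroup_prod S)
    semigroup_pairing semigroup_pairing_mulg.

End ProductMorphisms.

Section Image.
Variables (A B : finSemigroupType) (f : {multiplicative A -> B}).

Fact image_mulg_closed : mulg_closed (f @: [set: A]).
Proof.
move=> _ _ /imsetP[a _ ->] /imsetP[b _ ->].
by rewrite -gmulfM imset_f ?inE.
Qed.

Definition image_subsemigroup : subsemigroup B :=
  Subsemigroup image_mulg_closed.

End Image.

(** * Transfer of membership in a pseudovariety *)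

(** The image of an embedding f : A -> B is a subsemigroup of B, and the
    inverse of f maps it homomorphically onto A. *)
Lemma pv_embedding (V : pseudovariety) (A B : finSemigroupType)
  (f : {multiplicative A -> B}) : injective f -> V B -> V A.
Proof.
have [sub quo _] := pv_classP V; move=> f_inj VB.
pose E := image_subsemigroup f.
have finv (x : semigroup_of E) : {a | f a == val x}.
  by apply: sigW; have /imsetP[a _ ->] := valP x; exists a.
pose g x := sval (finv x).
have fg x : f (g x) = val x by apply/eqP; apply: (svalP (finv x)).
have gM : {morph g : x y / x * y}.
  by move=> x y; apply: f_inj; rewrite gmulfM !fg.
pose gm := HB.pack_for {multiplicative (semigroup_of E) -> A} g
  (isMultiplicative.Build (semigroup_of E) A g gM).
apply: (quo (semigroup_of E) A gm); last exact: sub.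
move=> a; have fa : f a \in E by apply: imset_f; rewrite inE.
by exists (SubsemigroupElt fa); apply: f_inj; rewrite [LHS]fg.
Qed.

Lemma pv_corestrict (V : pseudovariety) (A B : finSemigroupType)
    (f : {multiplicative A -> B}) (W : subsemigroup B) :
  injective f -> (forall x, f x \in W) -> V (semigroup_of W) -> V A.
Proof.
move=> f_inj fW; apply: (@pv_embedding V A _ (corestrict fW)).
by move=> x y /(congr1 val); apply: f_inj.
Qed.

Lemma pv_image (V : pseudovariety) (S T : finSemigroupType)
    (phi : {multiplicative S -> T}) (U : subsemigroup S) (W : subsemigroup T) :
  phi @: U = W -> V (semigroup_of U) -> V (semigroup_of W).
Proof.
move=> phiU; have [_ quo _] := pv_classP V.
pose f : {multiplicative (semigroup_of U) -> T} := phi \o @subsemigroup_incl S U.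
have fW x : f x \in W by rewrite -phiU; apply: imset_f; apply: (valP x).
apply: (quo _ _ (corestrict fW)) => -[y Wy].
have /imsetP[x Ux yE] : y \in phi @: U by rewrite phiU.
by exists (SubsemigroupElt Ux); apply: val_inj.
Qed.

(** * The pseudovariety of semigroups with prescribed contexts *)

Section InPseudovariety.
Variables (O : context_specifier) (V : pseudovariety).

Lemma In_class_sub (S : finSemigroupType) (U : subsemigroup S) :
  In_class O V S -> In_class O V (semigroup_of U).
Proof.
have [incl _] := context_ruleP O; move=> VS W OW.
have [X OX /subsetP WX] := incl _ _ (@subsemigroup_incl S U) W OW.
pose f : {multiplicative (semigroup_of W) -> S} :=
  @subsemigroup_incl S U \o @subsemigroup_incl _ W.
apply: (@pv_corestrict V _ _ f X); last exact: VS.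
- by move=> x y /val_inj/val_inj.
- by move=> x; apply/WX/imset_f/(valP x).
Qed.

Lemma In_class_quo (S T : finSemigroupType) (phi : {multiplicative S -> T}) :
  surjective phi -> In_class O V S -> In_class O V T.
Proof.
have [_ lift] := context_ruleP O; move=> phi_surj VS U OU.
have [X OX phiX] := lift _ _ phi U phi_surj OU.
by apply: (pv_image phiX); apply: VS.
Qed.

(** A context U of a product projects into a context X_i of each factor, so
    that U embeds in the product of the X_i. *)
Lemma In_class_prod (I : finType) (S : I -> finSemigroupType) :
  (forall i, In_class O V (S i)) -> In_class O V (semigroup_prod S).
Proof.
have [incl _] := context_ruleP O; have [_ _ prd] := pv_classP V.
move=> VS U OU.
have /fin_all_exists2[X OX UX] i := incl _ _ (@semigroup_proj I S i) U OU.
pose p i : {multiplicative (semigroup_of U) -> S i} :=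
  @semigroup_proj I S i \o @subsemigroup_incl _ U.
have pX i x : p i x \in X i by apply/(subsetP (UX i))/imset_f/(valP x).
pose f : {multiplicative (semigroup_of U) ->
    semigroup_prod (fun i => semigroup_of (X i))} :=
  semigroup_pairing (fun i => corestrict (pX i)).
apply: (@pv_embedding V _ _ f); last by apply: prd => i; apply: VS.
move=> x y /ffunP fxy; apply/val_inj/ffunP => i.
by move: (fxy i); rewrite !ffunE => /(congr1 val).
Qed.

Lemma In_classP : is_pseudovariety (In_class O V).
Proof.
split=> [S U|S T phi|I S]; first exact: In_class_sub.
- exact: In_class_quo.
- exact: In_class_prod.
Qed.

Definition In_pseudovariety : pseudovariety := Pseudovariety In_classP.

End InPseudovariety.

(** * Directed joins *)

Lemma pv_joinS (F : pseudovariety -> Prop) (V : pseudovariety) :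
  F V -> V `<=` pv_join F.
Proof. by move=> FV S VS Z joinZ; apply: joinZ; exists V. Qed.

Lemma pv_join_le (F : pseudovariety -> Prop) (W : pseudovariety) :
  (forall V, F V -> V `<=` W) -> pv_join F `<=` W.
Proof. by move=> FW S; apply=> T [V FV VT]; apply: (FW V). Qed.

(** Finitely many properties, each inherited by larger pseudovarieties, hold
    at once for some member of a directed family as soon as each of them holds
    for some member. *)
Lemma directed_common (F : pseudovariety -> Prop) (I : finType)
    (P : I -> pseudovariety -> Prop) :
  directed F ->
  (forall i (V W : pseudovariety), V `<=` W -> P i V -> P i W) ->
  (forall i, exists2 V, F V & P i V) ->
  exists2 V, F V & forall i, P i V.
Proof.
move=> [[V0 FV0] dirF] Pup exP.
suff [V FV PV] : exists2 V, F V & forall i, i \in enum I -> P i V.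
  by exists V => // i; apply: PV; rewrite mem_enum.
elim: (enum I) => [|i s [V FV PV]]; first by exists V0.
have [W FW PW] := exP i; have [Z [FZ VZ WZ]] := dirF V W FV FW.
exists Z => // j; rewrite inE => /predU1P[->|/PV PVj].
  exact: Pup WZ PW.
exact: Pup VZ PVj.
Qed.

(** Only products need an argument: finitely many factors taken from members
    of F all lie in a single one. *)
Lemma directed_unionP (F : pseudovariety -> Prop) : directed F ->
  is_pseudovariety (fun S => exists2 V : pseudovariety, F V & V S).
Proof.
move=> dirF; split=> [S U [V FV VS]|S T phi phi_surj [V FV VS]|I S exV].
- by exists V => //; have [sub _ _] := pv_classP V; apply: sub.
- by exists V => //; have [_ quo _] := pv_classP V; apply: (quo S T phi).
have [|V FV VS] := @directed_common F I (fun i V => V (S i)) dirF _ exV.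
  by move=> i V W VW; apply: VW.
by exists V => //; have [_ _ prd] := pv_classP V; apply: prd.
Qed.

Lemma pv_join_directed (F : pseudovariety -> Prop) (S : finSemigroupType) :
  directed F -> pv_join F S -> exists2 V : pseudovariety, F V & V S.
Proof.
by move=> dirF joinS; apply: (joinS (Pseudovariety (directed_unionP dirF))).
Qed.

(** * The adjunction *)

Lemma Gen_leP (O : context_specifier) (V W : pseudovariety) :
  Gen O V `<=` W <-> V `<=` In_pseudovariety O W.
Proof.
split=> [GW S VS U OU | VW T GT].
  by apply: GW => Z; apply; exists S; split=> //; exists U.
by apply: GT => _ [S [VS [U OU ->]]]; apply: (VW S).
Qed.

Lemma In_increasing (O : context_specifier) : increasing (In_pseudovariety O).
Proof. by move=> V S VS U _; have [sub _ _] := pv_classP V; apply: sub. Qed.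

Lemma In_monotone (O : context_specifier) : monotone (In_pseudovariety O).
Proof. by move=> V W VW S VS U OU; apply/VW/VS. Qed.

Lemma Gen_monotone (O : context_specifier) : monotone (Gen O).
Proof.
by move=> V W VW; apply/Gen_leP => S /VW; move: S; apply/Gen_leP.
Qed.

(** * Continuity *)

(** The finiteness argument: S has finitely many contexts, each of them lying
    in some member of F. *)
Lemma In_directed (O : context_specifier) (F : pseudovariety -> Prop)
    (S : finSemigroupType) :
  directed F -> In_pseudovariety O (pv_join F) S ->
  exists2 V, F V & In_pseudovariety O V S.
Proof.
move=> dirF VS.
(* Subsemigroups carry a proof of closure, so it is their underlying sets that
   range over a finite type; contexts with the same underlying set are
   isomorphic. *)
pose P (A : {set S}) (V : pseudovariety) :=
  forall U : subsemigroup S, U = A :> {set S} -> O S U -> V (semigroup_of U).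
have [|A|V FV PV] := @directed_common F {set S} P dirF.
- by move=> A V W VW PV U UA OU; apply/VW/PV.
- have [[U [UA OU]]|noU] :=
    classic (exists U : subsemigroup S, U = A :> {set S} /\ O S U); last first.
    by have [[V FV] _] := dirF; exists V => // U UA OU; case: noU; exists U.
  have [V FV VU] := pv_join_directed dirF (VS U OU).
  exists V => // U' U'A _.
  apply: (@pv_corestrict V _ S (@subsemigroup_incl S U') U) => //.
    exact: val_inj.
  by move=> x; rewrite UA -U'A; apply: (valP x).
- by exists V => // U OU; apply: (PV U).
Qed.

Lemma In_continuous (O : context_specifier) : continuous (In_pseudovariety O).
Proof.
split=> [|F dirF S]; first exact: In_monotone.
split=> [/(In_directed dirF)[V FV VS] | ].
  by apply: (pv_joinS (V := In_pseudovariety O V)) VS; exists V.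
by apply: pv_join_le => _ [V FV ->]; apply/In_monotone/pv_joinS.
Qed.

Theorem mainTheorem7 (O : context_specifier) :
  exists In : pseudovariety -> pseudovariety,
    [/\ forall (V : pseudovariety) (S : finSemigroupType),
          In V S <-> In_class O V S,
        galois_connection (Gen O) In,
        continuous In,
        increasing In
      & decreasing (Gen O)].
Proof.
exists (In_pseudovariety O); split=> //.
- split; [exact: Gen_monotone | exact: In_monotone | exact: Gen_leP].
- exact: In_continuous.
- exact: In_increasing.
- by move=> V; apply/Gen_leP/In_increasing.
Qed.
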